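(* Let $d\ge1$, $\lambda>0$, $\delta>0$, and let $f:\mathbb{R}^d\to\mathbb{R}$ be convex and satisfy: (A1) $f$ is continuous and has at least one minimizer; (A2) $\int_{\mathbb{R}^d}\exp(-f(y)/\delta)\,dy<+\infty$. Then for every $x\in\mathbb{R}^d$, \[\nabla f^{\lambda,\delta}(x)\in\partial_{d\delta}f\big(\operatorname{zprox}^\delta_{\lambda,f}(x)\big).\] Consequently, for the ZOPPA sequence $(x^k)$ and $X^\star=\operatorname{argmin}f$, for all $k\ge1$, \[f(x^k)-\min_yf(y)\le\|\nabla f^{\lambda,\delta}(x^{k-1})\|\operatorname{dist}(x^k,X^\star)+d\delta.\]
   Context: For $\varepsilon\ge0$, the $\varepsilon$-subdifferential is $\partial_\varepsilon f(z)=\{g\in\mathbb{R}^d: f(y)\ge f(z)+\langle g,y-z\rangle-\varepsilon\ \forall y\in\mathbb{R}^d\}$. The zeroth-order proximal operator is $\operatorname{zprox}^\delta_{\lambda,f}(x)=\dfrac{\mathbb{E}_{y\sim\mathcal N(x,\lambda\delta I)}[y\exp(-f(y)/\delta)]}{\mathbb{E}_{y\sim\mathcal N(x,\lambda\delta I)}[\exp(-f(y)/\delta)]}$; the soft Moreau envelope is $f^{\lambda,\delta}(x)=-\delta\log\mathbb{E}_{y\sim\mathcal N(x,\lambda\delta I)}[\exp(-f(y)/\delta)]$. ZOPPA: $x^{k+1}=\operatorname{zprox}^\delta_{\lambda,f}(x^k)$ from any $x^0$. *)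

(* Defs.v *)
From HB Require Import structures.
From mathcomp Require Import all_boot all_order all_algebra.
From mathcomp Require Import all_classical all_reals all_analysis.
Set Implicit Arguments. Unset Strict Implicit. Unset Printing Implicit Defensive.
Import Order.TTheory GRing.Theory Num.Theory.
Import numFieldNormedType.Exports.
Local Open Scope classical_set_scope.
Local Open Scope ring_scope.

Section Defs.
Variable R : realType.

Definition dotv (d : nat) (u v : 'rV[R]_d) : R := \sum_(i < d) u 0 i * v 0 i.
Definition enorm (d : nat) (u : 'rV[R]_d) : R := Num.sqrt (dotv u u).

(** Lebesgue integral over R^d, written as the iterated Lebesgue integral
    over R (Fubini), first coordinate outermost. Real-valued version. *)
Fixpoint intRd (d : nat) : ('rV[R]_d -> R) -> R :=
  match d return ('rV[R]_d -> R) -> R with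
  | 0 => fun g => g 0
  | n.+1 => fun g =>
      Rintegral (@lebesgue_measure R) setT
        (fun t : R => intRd (fun v : 'rV[R]_n => g (row_mx (t%:M : 'rV[R]_1) v)))
  end.

(** Extended-real valued version (for nonnegative integrands, to state
    finiteness of integrals). *)
Fixpoint eintRd (d : nat) : ('rV[R]_d -> \bar R) -> \bar R :=
  match d return ('rV[R]_d -> \bar R) -> \bar R with
  | 0 => fun g => g 0
  | n.+1 => fun g =>
      (\int[@lebesgue_measure R]_(t in setT)
        eintRd (fun v : 'rV[R]_n => g (row_mx (t%:M : 'rV[R]_1) v)))%E
  end.

Definition gauss_dens (d : nat) (s : R) (x y : 'rV[R]_d) : R :=
  ((2 * pi * s) `^ (d%:R / 2))^-1 * expR (- (dotv (y - x) (y - x)) / (2 * s)).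

Definition gaussE (d : nat) (s : R) (x : 'rV[R]_d) (h : 'rV[R]_d -> R) : R :=
  intRd (fun y => gauss_dens s x y * h y).

Definition zprox (d : nat) (lam del : R) (f : 'rV[R]_d -> R) (x : 'rV[R]_d)
  : 'rV[R]_d :=
  (gaussE (lam * del) x (fun y => expR (- f y / del)))^-1 *:
  \row_(i < d) gaussE (lam * del) x (fun y => y 0 i * expR (- f y / del)).

Definition soft_moreau (d : nat) (lam del : R) (f : 'rV[R]_d -> R)
  (x : 'rV[R]_d) : R :=
  - del * ln (gaussE (lam * del) x (fun y => expR (- f y / del))).

(** Gradient: vector of partial derivatives (meaningful when F is
    differentiable). *)
Definition grad (d : nat) (F : 'rV[R]_d -> R) (x : 'rV[R]_d) : 'rV[R]_d :=
  \row_(i < d) ('D_(delta_mx 0 i) F x).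

Definition eps_subdiff (d : nat) (f : 'rV[R]_d -> R) (eps : R) (z : 'rV[R]_d)
  : set 'rV[R]_d :=
  [set g | forall y, f z + dotv g (y - z) - eps <= f y].

Definition convex_fun (d : nat) (f : 'rV[R]_d -> R) : Prop :=
  forall (x y : 'rV[R]_d) (t : R), 0 <= t <= 1 ->
    f (t *: x + (1 - t) *: y) <= t * f x + (1 - t) * f y.

Definition argmin (d : nat) (f : 'rV[R]_d -> R) : set 'rV[R]_d :=
  [set y | forall z, f y <= f z].

Definition dist_set (d : nat) (x : 'rV[R]_d) (S : set 'rV[R]_d) : R :=
  inf [set enorm (x - y) | y in S].

Definition zoppa_seq (d : nat) (lam del : R) (f : 'rV[R]_d -> R)
  (xs : nat -> 'rV[R]_d) : Prop :=
  forall k, xs k.+1 = zprox lam del f (xs k).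

End Defs.

(* Main.v *)
Require Import Defs.
From HB Require Import structures.
From mathcomp Require Import all_boot all_order all_algebra.
From mathcomp Require Import all_classical all_reals all_analysis.
From mathcomp Require Import measurable_realfun ring lra.
Import Order.TTheory GRing.Theory Num.Theory.
Import numFieldNormedType.Exports.
Local Open Scope classical_set_scope.
Local Open Scope ring_scope.

(** Fix [x] and let [p y] be proportional to
    [exp (- f y / del - |y - x|^2 / (2 lam del))], so that [z := zprox x] is the
    mean of the probability density [p / Z], and
    [grad (soft_moreau f) x = (x - z) / lam] by differentiating a Laplace
    transform. Dilating about a point [y0] with ratio [1 - r] gives
    [\int p ((1 - r) y + r y0) dy = (1 - r)^(-d) Z]. On the other hand, by
    convexity of [f] along the segment [y, y0], a subgradient [a] of [f] at [z]
    and [exp t >= 1 + t], the left-hand side is at least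
    [Z + r / del * (w0 Z + O(r))] with
    [w0 = f z - f y0 + <z - x, z - y0> / lam], the terms linear in [y - z]
    having integral zero. Letting [r] tend to 0 yields [w0 <= d del], which is
    the claimed subgradient inequality at [y0]. *)

Set Implicit Arguments.
Unset Strict Implicit.

(** * Row vectors built coordinate by coordinate, and the Euclidean inner product *)

Section EuclideanSpace.
Variable R : realType.
Implicit Types (n : nat) (t : R).

(** Convertible to the vector inside the successor case of [intRd], so inductions on the dimension
    can be phrased with [consv]. *)
Definition consv n t (v : 'rV[R]_n) : 'rV[R]_n.+1 :=
  row_mx (t%:M : 'rV[R]_1) v.

Lemma consv0 n t (v : 'rV[R]_n) : consv t v 0 0 = t.
Proof.
transitivity (row_mx (t%:M : 'rV_1) v 0 (lshift n 0)); last by rewrite row_mxEl !mxE.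
by congr (row_mx _ _ _ _); apply: val_inj.
Qed.

Lemma consvS n t (v : 'rV[R]_n) i : consv t v 0 (lift 0 i) = v 0 i.
Proof.
by rewrite -[RHS](row_mxEr (t%:M : 'rV_1)); congr (row_mx _ _ _ _); apply: val_inj.
Qed.

Definition consvE := (consv0, consvS).

Lemma rowvP n (u v : 'rV[R]_n.+1) :
  u 0 0 = v 0 0 -> (forall i, u 0 (lift 0 i) = v 0 (lift 0 i)) -> u = v.
Proof.
move=> h0 hS; apply/rowP => i.
by case: (unliftP 0 i) => [j ->|->].
Qed.

Lemma consv_surj n (u : 'rV[R]_n.+1) :
  u = consv (u 0 0) (\row_i u 0 (lift 0 i)).
Proof. by apply: rowvP => [|i]; rewrite !consvE ?mxE. Qed.

Lemma consvD n t s (v w : 'rV[R]_n) :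
  consv t v + consv s w = consv (t + s) (v + w).
Proof. by apply: rowvP => [|i]; rewrite mxE !consvE ?mxE. Qed.

Lemma consvZ n t s (v : 'rV[R]_n) : s *: consv t v = consv (s * t) (s *: v).
Proof. by apply: rowvP => [|i]; rewrite mxE !consvE ?mxE. Qed.

Lemma dotv_consv n t s (v w : 'rV[R]_n) :
  dotv (consv t v) (consv s w) = t * s + dotv v w.
Proof.
rewrite /dotv big_ord_recl !consv0; congr (_ + _).
by apply: eq_bigr => i _; rewrite !consvS.
Qed.

Lemma dotvC n (u v : 'rV[R]_n) : dotv u v = dotv v u.
Proof. by apply: eq_bigr => i _; rewrite mulrC. Qed.

Lemma dotvDr n (u v w : 'rV[R]_n) : dotv u (v + w) = dotv u v + dotv u w.
Proof. by rewrite -big_split; apply: eq_bigr => i _; rewrite mxE mulrDr. Qed.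

Lemma dotvZr n a (u v : 'rV[R]_n) : dotv u (a *: v) = a * dotv u v.
Proof.
rewrite mulr_sumr; apply: eq_bigr => i _.
by rewrite mxE mulrCA.
Qed.

Lemma dotvNr n (u v : 'rV[R]_n) : dotv u (- v) = - dotv u v.
Proof. by rewrite -scaleN1r dotvZr mulN1r. Qed.

Lemma dotvDl n (u v w : 'rV[R]_n) : dotv (v + w) u = dotv v u + dotv w u.
Proof. by rewrite !(dotvC _ u) dotvDr. Qed.

Lemma dotvZl n a (u v : 'rV[R]_n) : dotv (a *: v) u = a * dotv v u.
Proof. by rewrite !(dotvC _ u) dotvZr. Qed.

Lemma dotvNl n (u v : 'rV[R]_n) : dotv (- v) u = - dotv v u.
Proof. by rewrite !(dotvC _ u) dotvNr. Qed.

Definition dotvE := (dotvDl, dotvDr, dotvNl, dotvNr, dotvZl, dotvZr).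

Lemma dotv_ge0 n (u : 'rV[R]_n) : 0 <= dotv u u.
Proof. by apply: sumr_ge0 => i _; rewrite -expr2 sqr_ge0. Qed.

(** Cauchy-Schwarz: for [v] nonzero, expand the squared norm of [dotv v v *: u - dotv u v *: v] and
    cancel the factor [dotv v v]. *)
Lemma dotv_le_enorm n (u v : 'rV[R]_n) : dotv u v <= enorm u * enorm v.
Proof.
rewrite /enorm -sqrtrM ?dotv_ge0//.
apply: (le_trans (ler_norm _)); rewrite -sqrtr_sqr ler_sqrt; last first.
  by rewrite mulr_ge0 ?dotv_ge0.
have [vv0|vv0] := eqVneq (dotv v v) 0.
  have -> : dotv u v = 0.
    apply: big1 => i _; suff -> : v 0 i = 0 by rewrite mulr0.
    have := vv0; move/eqP; rewrite psumr_eq0 => [/allP /(_ i)|]; last first.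
      by move=> j _; rewrite -expr2 sqr_ge0.
    by rewrite mem_index_enum mulf_eq0 orbb => /(_ isT) /eqP.
  by rewrite expr0n/= vv0 mulr0.
have := dotv_ge0 (dotv v v *: u - dotv u v *: v).
rewrite !dotvE (dotvC v u) => h.
have {}h : 0 <= dotv v v * (dotv u u * dotv v v - dotv u v ^+ 2).
  by apply: le_trans h _; rewrite le_eqVlt; apply/orP; left; apply/eqP; ring.
by move: h; rewrite pmulr_rge0 ?subr_ge0// lt_neqAle eq_sym vv0 dotv_ge0.
Qed.

Lemma consv_continuousr n t : continuous (@consv n t).
Proof.
move=> v A /nbhs_ballP[e /= e0 eA]; apply/nbhs_ballP; exists e => //= w.
move=> [_ vw]; apply: eA; split=> // i j; rewrite (ord1 i).
by case: (unliftP 0 j) => [k ->|->]; rewrite !consvE//; apply: ballxx.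
Qed.

Lemma consv_continuousl n (v : 'rV[R]_n) : continuous (fun t => consv t v).
Proof.
move=> t A /nbhs_ballP[e /= e0 eA]; apply/nbhs_ballP; exists e => //= w.
move=> vw; apply: eA; split=> // i j; rewrite (ord1 i).
by case: (unliftP 0 j) => [k ->|->]; rewrite !consvE//; apply: ballxx.
Qed.

End EuclideanSpace.

(** * Iterated integrals of continuous functions with Gaussian bounds *)

Section GaussianDomination.
Variable R : realType.
Local Notation mu := (@lebesgue_measure R).

Lemma integrable_expRNsqr (c : R) : 0 < c ->
  mu.-integrable setT (fun t => (expR (- c * t ^+ 2))%:E).
Proof.
(* With variance [s ^+ 2 = (2 * c)^-1], the centered normal density is proportional to
   [expR (- c * t ^+ 2)]. *)
move=> c0; pose s := Num.sqrt (2 * c)^-1.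
have s0 : s != 0 by rewrite gt_eqF// sqrtr_gt0 invr_gt0 mulr_gt0.
have := @integrable_normal_pdf R 0 s.
rewrite normal_pdfE// => /(integrableZl measurableT (normal_peak s)^-1) h.
apply: eq_integrable h => // t _ /=; rewrite -EFinM mulrA mulVf ?mul1r.
  rewrite /normal_fun; congr (expR _)%:E; rewrite subr0 sqr_sqrtr;
    last by rewrite invr_ge0 mulr_ge0// ltW.
  by rewrite -mulr_natl; field; rewrite ?gt_eqF.
by rewrite gt_eqF// normal_peak_gt0.
Qed.

Lemma continuous_integrable (h : R -> R) (C c : R) : 0 < c -> continuous h ->
  (forall t, `|h t| <= C * expR (- c * t ^+ 2)) ->
  mu.-integrable setT (EFin \o h).
Proof.
move=> c0 hc hb.
apply: (le_integrable _ _ _ (integrableZl measurableT C (integrable_expRNsqr c0))) => //.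
  apply/measurable_EFinP; exact: (continuous_measurable_fun hc).
by move=> t _ /=; rewrite lee_fin; apply: le_trans (hb t) (ler_norm _).
Qed.

Lemma Rintegral_dominated_cvg (hs : nat -> R -> R) (h : R -> R) (C c : R) :
  0 < c -> (forall k, continuous (hs k)) -> continuous h ->
  (forall k t, `|hs k t| <= C * expR (- c * t ^+ 2)) ->
  (forall t, hs ^~ t @ \oo --> h t) ->
  (\int[mu]_t hs k t) @[k --> \oo] --> \int[mu]_t h t.
Proof.
move=> c0 hsc hc hb hsh.
have dc : (\int[mu]_t (hs k t)%:E)%E @[k --> \oo] --> (\int[mu]_t (h t)%:E)%E.
  apply: (@dominated_cvg _ _ _ mu setT measurableT
    (fun k t => (hs k t)%:E) (EFin \o h)
    (fun t => (C * expR (- c * t ^+ 2))%:E)) => //.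
  - by move=> k; apply/measurable_EFinP; exact: (continuous_measurable_fun (hsc k)).
  - by move=> t _; apply: cvg_EFin; [apply: nearW => k|exact: hsh].
  - exact: (integrableZl measurableT C (integrable_expRNsqr c0)).
  - by move=> k t _ /=; rewrite lee_fin.
apply: fine_cvg; rewrite fineK//.
apply: integrable_fin_num => //.
(* The bound passes to the pointwise limit, so the limit integral is finite and the convergence
   descends from extended reals to reals. *)
have hb' t : `|h t| <= C * expR (- c * t ^+ 2).
  have nh : `|hs k t| @[k --> \oo] --> `|h t| by apply: cvg_norm; exact: hsh.
  move/cvg_lim : (nh) => <-//.
  by apply: limr_le; [apply/cvg_ex; exists (`|h t|)|apply: nearW => k].
exact: continuous_integrable hb'.
Qed.

(** Every integrand below satisfies such a bound. The class is stable under
    freezing the first coordinate and under integrating the others out, so the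
    one-dimensional integration theorems iterate through [intRd]. *)
Definition gdom n (C c : R) (g : 'rV[R]_n -> R) :=
  continuous g /\ forall y, `|g y| <= C * expR (- c * dotv y y).

Lemma gdom_cons n (C c : R) (g : 'rV[R]_n.+1 -> R) t : gdom C c g ->
  gdom (C * expR (- c * t ^+ 2)) c (fun v => g (consv t v)).
Proof.
move=> [gc gb]; split=> [v|v].
  by apply: (@continuous_comp _ _ _ (consv t) g);
    [exact: consv_continuousr|exact: gc].
by rewrite -mulrA -expRD -mulrDr expr2 -dotv_consv.
Qed.

Let K (c : R) := \int[mu]_t expR (- c * t ^+ 2).

Let bounded_by n := forall (C c : R) (g : 'rV[R]_n -> R), 0 < c -> gdom C c g ->
  `|intRd g| <= C * K c ^+ n.

Let cvg_dom n := forall (C c : R) (gs : nat -> 'rV[R]_n -> R) (g : 'rV[R]_n -> R),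
  0 < c -> (forall k, gdom C c (gs k)) -> gdom C c g ->
  (forall y, gs ^~ y @ \oo --> g y) -> intRd (gs k) @[k --> \oo] --> intRd g.

Let section_bound n (C c : R) (g : 'rV[R]_n.+1 -> R) : bounded_by n ->
  0 < c -> gdom C c g ->
  forall t, `|intRd (fun v => g (consv t v))| <= C * K c ^+ n * expR (- c * t ^+ 2).
Proof.
move=> bn c0 gg t; apply: le_trans (bn _ _ _ c0 (gdom_cons t gg)) _.
by rewrite mulrAC.
Qed.

(** Continuity is tested along sequences [u] tending to [t], where dominated convergence in
    dimension [n] applies. *)
Let section_continuous n (C c : R) (g : 'rV[R]_n.+1 -> R) : cvg_dom n ->
  0 < c -> gdom C c g -> continuous (fun t => intRd (fun v => g (consv t v))).
Proof.
move=> cn c0 gg t; apply/(@cvg_nbhsP _ R^o) => u ut.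
have C0 : 0 <= C.
  have := (le_trans (normr_ge0 _) (gg.2 0)).
  by rewrite pmulr_lge0 ?expR_gt0.
apply: (cn C c) => //.
(* Dropping the factor [expR (- c * u k ^+ 2)], at most 1, makes the bound uniform in [k]. *)
- move=> k; have [gc gb] := gdom_cons (u k) gg; split=> // y.
  apply: le_trans (gb y) _; rewrite ler_wpM2r ?expR_ge0// ler_piMr//.
  by rewrite -expR0 ler_expR mulNr oppr_le0 mulr_ge0 ?sqr_ge0// ltW.
- have [gc gb] := gdom_cons t gg; split=> // y.
  apply: le_trans (gb y) _; rewrite ler_wpM2r ?expR_ge0// ler_piMr//.
  by rewrite -expR0 ler_expR mulNr oppr_le0 mulr_ge0 ?sqr_ge0// ltW.
- move=> v; have cg : {for t, continuous (g \o (fun s => consv s v))}.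
    by apply: continuous_comp; [exact: consv_continuousl|exact: gg.1].
  exact: (continuous_cvg _ cg ut).
Qed.

(** The induction needs both statements at once: in the next dimension, the outer integrand gets its
    bound from the first and its continuity, hence measurability, from the second. *)
Let bounded_cvg n : bounded_by n /\ cvg_dom n.
Proof.
elim: n => [|n [bn cn]].
  split=> [C c g c0 [_ /(_ 0)]|C c gs g c0 _ _ /(_ 0)]//=.
  by rewrite /dotv big_ord0 mulr0 expR0.
split=> [C c g c0 gg|C c gs g c0 gsg gg gsc] /=.
  have hb := section_bound bn c0 gg.
  have hi := continuous_integrable c0 (section_continuous cn c0 gg) hb.
  apply: le_trans (le_normr_Rintegral measurableT hi) _.
  rewrite exprSr mulrA -RintegralZl//; last exact: integrable_expRNsqr.
  apply: le_Rintegral => //; first exact: integrable_norm.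
  exact: (integrableZl measurableT _ (integrable_expRNsqr c0)).
apply: (Rintegral_dominated_cvg c0 _ _ (fun k => section_bound bn c0 (gsg k))).
- by move=> k; exact: (section_continuous cn c0 (gsg k)).
- exact: (section_continuous cn c0 gg).
- move=> t; apply: (cn _ _ _ _ c0 (fun k => gdom_cons t (gsg k)) (gdom_cons t gg)).
  by move=> v; exact: gsc.
Qed.

Definition gdominated n (g : 'rV[R]_n -> R) :=
  exists C c, 0 < c /\ gdom C c g.

Lemma gdominated_cons n (g : 'rV[R]_n.+1 -> R) t :
  gdominated g -> gdominated (fun v => g (consv t v)).
Proof.
move=> [C [c [c0 gg]]]; exists (C * expR (- c * t ^+ 2)), c; split=> //.
exact: gdom_cons.
Qed.

Lemma continuous_intRd_cons n (g : 'rV[R]_n.+1 -> R) : gdominated g ->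
  continuous (fun t => intRd (fun v => g (consv t v))).
Proof.
by move=> [C [c [c0]]]; apply: section_continuous => //; have [] := bounded_cvg n.
Qed.

Lemma integrable_intRd_cons n (g : 'rV[R]_n.+1 -> R) : gdominated g ->
  mu.-integrable setT (EFin \o (fun t => intRd (fun v => g (consv t v)))).
Proof.
move=> gg; have := continuous_intRd_cons gg; case: gg => [C [c [c0 gg]]] gc.
exact: (continuous_integrable c0 gc (section_bound (bounded_cvg n).1 c0 gg)).
Qed.

Lemma gdominatedD n (g h : 'rV[R]_n -> R) :
  gdominated g -> gdominated h -> gdominated (fun y => g y + h y).
Proof.
move=> [C [c [c0 [gc gb]]]] [C' [c' [c'0 [hc hb]]]].
exists (C + C'), (Num.min c c'); split; first by rewrite lt_min c0.
have C0 : 0 <= C.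
  by have := (le_trans (normr_ge0 _) (gb 0)); rewrite pmulr_lge0 ?expR_gt0.
have C'0 : 0 <= C'.
  by have := (le_trans (normr_ge0 _) (hb 0)); rewrite pmulr_lge0 ?expR_gt0.
split=> [y|y]; first exact: cvgD (gc y) (hc y).
apply: le_trans (ler_normD _ _) _; rewrite mulrDl; apply: lerD.
  apply: le_trans (gb y) _; rewrite ler_wpM2l// ler_expR !mulNr lerN2.
  by rewrite ler_wpM2r ?dotv_ge0// ge_min lexx.
apply: le_trans (hb y) _; rewrite ler_wpM2l// ler_expR !mulNr lerN2.
by rewrite ler_wpM2r ?dotv_ge0// ge_min lexx orbT.
Qed.

Lemma gdominatedZ n (a : R) (g : 'rV[R]_n -> R) :
  gdominated g -> gdominated (fun y => a * g y).
Proof.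
move=> [C [c [c0 [gc gb]]]]; exists (`|a| * C), c; split=> //.
split=> [y|y]; first exact: cvgM (cvg_cst _) (gc y).
by rewrite normrM -mulrA ler_wpM2l.
Qed.

Lemma gdominated_affine n (s : R) (b : 'rV[R]_n) (g : 'rV[R]_n -> R) : 0 < s ->
  gdominated g -> gdominated (fun y => g (s *: y + b)).
Proof.
move=> s0 [C [c [c0 [gc gb]]]].
have C0 : 0 <= C.
  by have := (le_trans (normr_ge0 _) (gb 0)); rewrite pmulr_lge0 ?expR_gt0.
exists (C * expR (c * dotv b b)), (c * s ^+ 2 / 2).
split; first by rewrite divr_gt0 ?mulr_gt0 ?exprn_gt0.
split=> [y|y].
  have : {for y, continuous (g \o (fun z : 'rV[R]_n => s *: z + b))}.
    apply: continuous_comp; last exact: gc.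
    have h := @scaler_continuous R (matrix R 1 n) s y. exact: (cvgD h (cvg_cst b)).
  exact.
apply: le_trans (gb _) _; rewrite -mulrA -expRD ler_wpM2l// ler_expR.
(* Half of this square is |s y + b|^2 - s^2 |y|^2 / 2 + |b|^2, which explains the rate and the
   constant chosen above. *)
have := dotv_ge0 (s *: y + 2 *: b); rewrite !dotvE (dotvC b y) => h.
nra.
Qed.

Lemma intRdD n (g h : 'rV[R]_n -> R) : gdominated g -> gdominated h ->
  intRd (fun y => g y + h y) = intRd g + intRd h.
Proof.
elim: n g h => [//|n IH] g h gg hh /=.
rewrite -(RintegralD measurableT (integrable_intRd_cons gg) (integrable_intRd_cons hh)).
apply: eq_Rintegral => t _.
by rewrite -(IH _ _ (gdominated_cons t gg) (gdominated_cons t hh)).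
Qed.

Lemma intRdZ n (a : R) (g : 'rV[R]_n -> R) : gdominated g ->
  intRd (fun y => a * g y) = a * intRd g.
Proof.
elim: n g => [//|n IH] g gg /=.
rewrite -(RintegralZl _ measurableT (integrable_intRd_cons gg)).
by apply: eq_Rintegral => t _; rewrite -(IH _ (gdominated_cons t gg)).
Qed.

Lemma intRd_sum n m (g : 'I_m -> 'rV[R]_n -> R) :
  (forall i, gdominated (g i)) ->
  gdominated (fun y => \sum_i g i y) /\
  intRd (fun y => \sum_i g i y) = \sum_i intRd (g i).
Proof.
elim: m g => [|m IH] g gg.
  have -> : (fun y => \sum_i g i y) = cst 0.
    by apply/funext => y; rewrite big_ord0.
  rewrite big_ord0; split.
    exists 0, 1; split=> //; split=> y; last by rewrite normr0 mul0r.
    by apply: cst_continuous.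
  elim: n {g gg} => [//|n IH] /=.
  under eq_Rintegral do rewrite IH.
  by rewrite Rintegral_cst// mul0r.
have [gS iS] := IH _ (fun i => gg (lift ord0 i)).
have -> : (fun y => \sum_i g i y) =
    (fun y => g ord0 y + \sum_i g (lift ord0 i) y).
  by apply/funext => y; rewrite big_ord_recl.
split; first exact: gdominatedD.
by rewrite intRdD// iS big_ord_recl.
Qed.

Lemma le_intRd n (g h : 'rV[R]_n -> R) : gdominated g -> gdominated h ->
  (forall y, g y <= h y) -> intRd g <= intRd h.
Proof.
elim: n g h => [|n IH] g h gg hh gh /=; first exact: gh.
refine (le_Rintegral measurableT (integrable_intRd_cons gg) (integrable_intRd_cons hh) _).
by move=> t _; exact: (IH _ _ (gdominated_cons t gg) (gdominated_cons t hh)).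
Qed.

Lemma intRd_ge0 n (g : 'rV[R]_n -> R) : (forall y, 0 <= g y) -> 0 <= intRd g.
Proof.
elim: n g => [|n IH] g g0 /=; first exact: g0.
by apply: Rintegral_ge0 => t _; apply: IH => v; exact: g0.
Qed.

Lemma intRd_gt0 n (g : 'rV[R]_n -> R) : gdominated g ->
  (forall y, 0 < g y) -> 0 < intRd g.
Proof.
elim: n g => [|n IH] g gg g0 /=; first exact: g0.
have G0 t : 0 < intRd (fun v => g (consv t v)).
  by exact: (IH _ (gdominated_cons t gg)).
have Gi := integrable_intRd_cons gg.
have GE : (\int[mu]_t (intRd (fun v => g (consv t v)))%:E)%E =
    (\int[mu]_t intRd (fun v => g (consv t v)))%:E.
  by rewrite -[LHS]fineK//; exact: integrable_fin_num.
rewrite lt_neqAle Rintegral_ge0 ?andbT; last by move=> t _; exact: (ltW (G0 t)).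
(* A zero integral would make the inner integral vanish almost everywhere; as it is positive
   everywhere, the whole line would be null. *)
apply/negP => /eqP G_eq0; move: GE; rewrite -G_eq0 => GE.
have [N [mN N0 GN]] :
    ae_eq mu setT (fun t => (intRd (fun v => g (consv t v)))%:E) (cst 0%E).
  apply/ae_eq_integral_abs => //; first by case/integrableP : Gi.
  by rewrite -[RHS]GE; apply: eq_integral => t _; rewrite gee0_abs// lee_fin ltW.
have : (mu setT <= mu N)%E.
  apply: le_measure; rewrite ?inE// => t _; apply: GN => /= /(_ I) [] Gt0.
  by have := G0 t; rewrite Gt0 ltxx.
by rewrite N0 -set_itvNyy lebesgue_measure_itv/= leNgt ltry.
Qed.

Lemma Rintegral_affine (G : R -> R) (s b : R) : 0 < s -> continuous G ->
  (forall t, 0 <= G t) ->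
  mu.-integrable setT (EFin \o (fun t => G (s * t + b))) ->
  s * (\int[mu]_t G (s * t + b)) = \int[mu]_t G t.
Proof.
move=> s0 cG G0 iG; pose F (u : R) := s * u + b.
have dF (t : R) : is_derive t 1 F s.
  by apply: is_derive_eq; rewrite addr0 -[RHS]mulr1.
have F'E : F^`()%classic = cst s.
  by apply/funext => t; rewrite derive1E derive_val.
rewrite mulrC -RintegralZr//; congr fine.
rewrite [RHS](increasing_ge0_integration_by_substitutionT (F := F))//.
- by rewrite F'E.
- by move=> x y xy; rewrite /F ltrD2r ltr_pM2l.
- by rewrite F'E; apply: cst_continuous.
- by rewrite F'E; exact: is_cvg_cst.
- by rewrite F'E; exact: is_cvg_cst.
- apply/cvgrNyPle => A; exists ((A - b) / s); split=> [|x]; first exact: num_real.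
  by rewrite ltr_pdivlMr// mulrC /F => /ltW; rewrite lerBrDr.
- apply/cvgryPge => A; exists ((A - b) / s); split=> [|x]; first exact: num_real.
  by rewrite ltr_pdivrMr// mulrC /F => /ltW; rewrite lerBlDr.
Qed.

(** One-dimensional substitution in each coordinate contributes one factor [s]. The dilation
    identity is the case [s = 1 - r], [b = r *: y0]. *)
Lemma intRd_affine n (s : R) (b : 'rV[R]_n) (g : 'rV[R]_n -> R) :
  0 < s -> gdominated g -> (forall y, 0 <= g y) ->
  s ^+ n * intRd (fun y => g (s *: y + b)) = intRd g.
Proof.
move=> s0; elim: n b g => [|n IH] b g gg g0.
  by rewrite mul1r /=; congr g; apply/rowP => -[].
have E t : s ^+ n * intRd (fun v => g (s *: consv t v + b)) =
    intRd (fun v => g (consv (s * t + b 0 0) v)).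
  rewrite -(IH (\row_i b 0 (lift 0 i)) _ (gdominated_cons _ gg))//.
  by congr (_ * intRd _); apply/funext => v; rewrite consvZ [in LHS](consv_surj b) consvD.
have ia := integrable_intRd_cons (gdominated_affine b s0 gg).
have -> : intRd g = \int[mu]_t intRd (fun v => g (consv t v)) by [].
rewrite -(@Rintegral_affine _ s (b 0 0))//.
- rewrite exprS -mulrA -(RintegralZl _ measurableT ia); congr (_ * _).
  by apply: eq_Rintegral => t _; rewrite E.
- exact: continuous_intRd_cons.
- by move=> t; apply: intRd_ge0 => v.
- have := integrableZl measurableT (s ^+ n) ia.
  by apply: eq_integrable => // t _ /=; rewrite -EFinM E.
Qed.

End GaussianDomination.

(** * Multipliers of at most exponential growth *)

Section SubexponentialGrowth.
Variable R : realType.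

Definition norm1 n (y : 'rV[R]_n) : R := \sum_i `|y 0 i|.

Lemma norm1_ge0 n (y : 'rV[R]_n) : 0 <= norm1 y.
Proof. exact: sumr_ge0. Qed.

(** Young's inequality in each coordinate: with t = |y_i|, the two sides differ by (k - c t)^2 / (2
    c). *)
Lemma norm1_le_dotv n (c k : R) (y : 'rV[R]_n) : 0 < c ->
  k * norm1 y <= n%:R * (k ^+ 2 / (2 * c)) + c / 2 * dotv y y.
Proof.
move=> c0; have -> : n%:R * (k ^+ 2 / (2 * c)) = \sum_(i < n) k ^+ 2 / (2 * c).
  by rewrite sumr_const card_ord mulr_natl.
rewrite /norm1 /dotv !mulr_sumr -big_split ler_sum// => i _ /=.
have -> : y 0 i * y 0 i = `|y 0 i| ^+ 2 by rewrite real_normK ?num_real.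
move: `|_| => t.
have -> : k ^+ 2 / (2 * c) + c / 2 * t ^+ 2 =
    k * t + (k - c * t) ^+ 2 / (2 * c) by field; rewrite gt_eqF.
by rewrite lerDl divr_ge0 ?sqr_ge0// mulr_ge0// ltW.
Qed.

(** An algebra containing the coordinates and the exponentials of linear forms, hence every factor
    that multiplies the Gibbs density below. *)
Definition subexp n (phi : 'rV[R]_n -> R) := continuous phi /\
  exists K k, [/\ 0 <= K, 0 <= k & forall y, `|phi y| <= K * expR (k * norm1 y)].

Lemma subexp_cst n (a : R) : @subexp n (fun=> a).
Proof.
split; first by move=> y; apply: cst_continuous.
by exists `|a|, 0; split=> // y; rewrite mul0r expR0 mulr1.
Qed.

Lemma subexpM n (phi psi : 'rV[R]_n -> R) :
  subexp phi -> subexp psi -> subexp (fun y => phi y * psi y).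
Proof.
move=> [c1 [K1 [k1 [K10 k10 b1]]]] [c2 [K2 [k2 [K20 k20 b2]]]].
split; first by move=> y; exact: cvgM (c1 y) (c2 y).
exists (K1 * K2), (k1 + k2); split; rewrite ?mulr_ge0 ?addr_ge0// => y.
by rewrite normrM mulrDl expRD mulrACA ler_pM.
Qed.

Lemma subexpD n (phi psi : 'rV[R]_n -> R) :
  subexp phi -> subexp psi -> subexp (fun y => phi y + psi y).
Proof.
move=> [c1 [K1 [k1 [K10 k10 b1]]]] [c2 [K2 [k2 [K20 k20 b2]]]].
split; first by move=> y; exact: cvgD (c1 y) (c2 y).
exists (K1 + K2), (k1 + k2); split; rewrite ?addr_ge0// => y.
rewrite (le_trans (ler_normD _ _))// mulrDl lerD//.
  rewrite (le_trans (b1 y))// ler_wpM2l// ler_expR.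
  by rewrite ler_wpM2r ?norm1_ge0// lerDl.
rewrite (le_trans (b2 y))// ler_wpM2l// ler_expR.
by rewrite ler_wpM2r ?norm1_ge0// lerDr.
Qed.

Lemma subexp_sum n m (phi : 'I_m -> 'rV[R]_n -> R) :
  (forall i, subexp (phi i)) -> subexp (fun y => \sum_i phi i y).
Proof.
elim: m phi => [|m IH] phi hphi.
  have -> : (fun y => \sum_i phi i y) = fun=> 0.
    by apply/funext => y; rewrite big_ord0.
  exact: subexp_cst.
have -> : (fun y => \sum_i phi i y) =
    (fun y => phi ord0 y + \sum_i phi (lift ord0 i) y).
  by apply/funext => y; rewrite big_ord_recl.
by apply: subexpD => //; apply: IH.
Qed.

Lemma subexp_coord n i : subexp (fun y : 'rV[R]_n => y 0 i).
Proof.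
split; first exact: coord_continuous.
exists 1, 1; split=> // y; rewrite !mul1r.
apply: le_trans (expR_ge1Dx _); rewrite /norm1 (bigD1 i)//= addrCA lerDl.
by rewrite addr_ge0// sumr_ge0.
Qed.

Lemma subexp_norm n (phi : 'rV[R]_n -> R) :
  subexp phi -> subexp (fun y => `|phi y|).
Proof.
move=> [c1 [K1 [k1 [K10 k10 b1]]]].
split; first by move=> y; exact: cvg_norm (c1 y).
by exists K1, k1; split=> // y; rewrite normr_id.
Qed.

Lemma subexp_norm1 n : subexp (@norm1 n).
Proof. by apply: subexp_sum => i; apply: subexp_norm; exact: subexp_coord. Qed.

Lemma subexp_expR n (phi : 'rV[R]_n -> R) k : 0 <= k -> subexp phi ->
  (forall y, phi y <= k * norm1 y) -> subexp (fun y => expR (phi y)).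
Proof.
move=> k0 [c1 _] b1; split.
  by move=> y; apply: continuous_comp; [exact: c1|exact: continuous_expR].
by exists 1, k; split=> // y; rewrite mul1r ger0_norm ?expR_ge0// ler_expR.
Qed.

Lemma subexp_dotv n (u v : 'rV[R]_n -> 'rV[R]_n) :
  (forall i, subexp (fun y => u y 0 i)) -> (forall i, subexp (fun y => v y 0 i)) ->
  subexp (fun y => dotv (u y) (v y)).
Proof. by move=> hu hv; apply: subexp_sum => i; exact: subexpM. Qed.

Lemma subexp_coordD n (w : 'rV[R]_n) i : subexp (fun y => (y + w) 0 i).
Proof.
have -> : (fun y => (y + w) 0 i) = (fun y => y 0 i + w 0 i).
  by apply/funext => y; rewrite mxE.
by apply: subexpD; [exact: subexp_coord|exact: subexp_cst].
Qed.

(** Half of the Gaussian rate is spent on absorbing the exponential growth of [phi]. *)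
Lemma gdominatedM n (g phi : 'rV[R]_n -> R) :
  gdominated g -> subexp phi -> gdominated (fun y => phi y * g y).
Proof.
move=> [C [c [c0 [gc gb]]]] [pc [K [k [K0 k0 pb]]]].
exists (K * expR (n%:R * (k ^+ 2 / (2 * c))) * C), (c / 2).
split; first by rewrite divr_gt0.
split=> [y|y]; first exact: cvgM (pc y) (gc y).
rewrite normrM; apply: le_trans (ler_pM _ _ (pb y) (gb y)) _ => //.
have C0 : 0 <= C.
  by have := (le_trans (normr_ge0 _) (gb 0)); rewrite pmulr_lge0 ?expR_gt0.
rewrite mulrACA -expRD [K * _ * C]mulrAC -[leRHS]mulrA -expRD.
rewrite ler_wpM2l ?mulr_ge0// ler_expR.
by have := norm1_le_dotv k y c0; lra.
Qed.

End SubexponentialGrowth.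

(** * Existence of subgradients of finite convex functions *)

Section Subgradient.
Variable R : realType.

(** Induction on the dimension: a subgradient of the slice through [z] with fixed first coordinate
    is extended by one coordinate. *)
Lemma convex_subgradient n (f : 'rV[R]_n -> R) z : convex_fun f ->
  exists a, forall y, f z + dotv a (y - z) <= f y.
Proof.
elim: n f z => [|n IH] f z cf.
  exists 0 => y; have -> : y = z by apply/rowP => -[].
  by rewrite subrr /dotv big_ord0 addr0.
rewrite (consv_surj z); move: (z 0 0) (\row_i _) => {z} z0 z.
have [|a fa] := IH (fun v => f (consv z0 v)) z.
  move=> u v t t01 /=; apply: le_trans (cf _ _ _ t01).
  by rewrite !consvZ consvD -mulrDl addrCA subrr addr0 mul1r.
(* A new first coordinate [p] works exactly when [p * t <= D t v] for all [t] and [v]. *)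
pose D (t : R) (v : 'rV[R]_n) : R :=
  f (consv (z0 + t) v) - f (consv z0 z) - dotv a (v - z).
(* Hahn-Banach step: the missing coordinate of the subgradient is any number
     separating the left slopes from the right slopes. *)
have slopes (s t : R) v w : 0 < s -> 0 < t -> - D (- s) w / s <= D t v / t.
  move=> s0 t0; rewrite ler_pdivrMr// mulrAC ler_pdivlMr// -subr_ge0.
  have st0 : 0 < s + t by rewrite addr_gt0.
  have th01 : 0 <= s / (s + t) <= 1.
    apply/andP; split; first by rewrite divr_ge0 ?ltW.
    by rewrite ler_pdivrMr// mul1r lerDl ltW.
  (* This weight puts the convex combination of the two points back on the slice of first coordinate
     [z0], where [fa] applies. *)
  set th := s / (s + t) in th01.
  have := cf (consv (z0 + t) v) (consv (z0 - s) w) th th01.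
  rewrite !consvZ consvD.
  have -> : th * (z0 + t) + (1 - th) * (z0 - s) = z0.
    by rewrite /th; field; rewrite gt_eqF.
  move=> /(le_trans (fa _)); rewrite -(ler_pM2l st0) => h.
  have E : dotv a (th *: v + (1 - th) *: w - z) =
      th * dotv a (v - z) + (1 - th) * dotv a (w - z) by rewrite !dotvE; ring.
  have thE : (s + t) * th = s by rewrite /th; field; rewrite gt_eqF.
  rewrite E in h; rewrite /D.
  have {}h : (s + t) * f (consv z0 z) + (s + t) * th * dotv a (v - z) +
      ((s + t) - (s + t) * th) * dotv a (w - z) <=
    (s + t) * th * f (consv (z0 + t) v) +
      ((s + t) - (s + t) * th) * f (consv (z0 - s) w).
    by apply: le_trans (le_trans _ h) _; rewrite le_eqVlt; apply/orP; left; apply/eqP; ring.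
  rewrite thE in h; lra.
pose S := [set x | exists s w, 0 < s /\ x = - D (- s) w / s].
have S0 : S (- D (- 1) z / 1) by exists 1, z.
have ubS t v : 0 < t -> ubound S (D t v / t).
  by move=> t0 _ [s [w [s0 ->]]]; exact: slopes.
exists (consv (sup S) a) => y; rewrite (consv_surj y).
move: (y 0 0) (\row_i _) => {y} y0 y.
have -> : consv y0 y - consv z0 z = consv (y0 - z0) (y - z).
  by rewrite -scaleN1r consvZ consvD !(mulN1r, scaleN1r).
rewrite dotv_consv.
have Dy : D (y0 - z0) y = f (consv y0 y) - f (consv z0 z) - dotv a (y - z).
  by rewrite /D (_ : z0 + (y0 - z0) = y0)//; ring.
have [yz|yz|->] := ltgtP y0 z0; last by rewrite subrr mulr0 add0r.
- have zy0 : 0 < z0 - y0 by rewrite subr_gt0.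
  have : - D (- (z0 - y0)) y / (z0 - y0) <= sup S.
    apply: ub_le_sup; last by exists (z0 - y0), y.
    by exists (D 1 z / 1); exact: ubS.
  by rewrite (opprB z0 y0) Dy ler_pdivrMr//; lra.
- have zy0 : 0 < y0 - z0 by rewrite subr_gt0.
  have : sup S <= D (y0 - z0) y / (y0 - z0).
    by apply: ge_sup; [exists (- D (- 1) z / 1)|exact: ubS].
  by rewrite Dy ler_pdivlMr//; lra.
Qed.

End Subgradient.

(** * Differentiability of Laplace transforms *)

Section LaplaceTransform.
Variable R : realType.

Lemma normr_coord_le n (y : 'rV[R]_n) i : `|y 0 i| <= `|y|.
Proof.
rewrite [leRHS]mx_normrE.
exact: (le_bigmax _ (fun ij : 'I_1 * 'I_n => `|y ij.1 ij.2|) (0, i)).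
Qed.

(** The library norm of a row vector is the maximum norm, which is dual to [norm1]. *)
Lemma dotv_le_norm1 n (u y : 'rV[R]_n) : `|dotv u y| <= `|u| * norm1 y.
Proof.
rewrite (le_trans (ler_norm_sum _ _ _))// mulr_sumr ler_sum// => i _.
by rewrite normrM ler_wpM2r// normr_coord_le.
Qed.

(** A remainder that is quadratic near 0 is little-o of the increment, so the differential is the
    given linear map. *)
Lemma is_diff_quadratic (V W : normedModType R) (F : V -> W)
    (dF : {linear V -> W}) x (M : R) : continuous dF ->
  (forall u, `|u| <= 1 -> `|F (u + x) - F x - dF u| <= M * `|u| ^+ 2) ->
  is_diff x F dF.
Proof.
move=> dFc FM.
have H : F \o shift x = cst (F x) + dF +o_ 0 id.
  apply/eqaddoP => e e0.
  have M1 : 0 < `|M| + 1 by rewrite ltr_wpDl.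
  apply: filterS2 (nbhs0_le (@ltr01 R)) (nbhs0_le (divr_gt0 e0 M1)) => u u1 ue.
  rewrite -[X in `|X|]/(F (u + x) - (F x + dF u)) opprD addrA.
  apply: le_trans (FM u u1) _; rewrite expr2 mulrA ler_wpM2r//.
  apply: (@le_trans _ _ ((`|M| + 1) * `|u|)); last by rewrite mulrC -ler_pdivlMr.
  by rewrite ler_wpM2r// (le_trans (ler_norm M))// lerDl.
have E : 'd F x = dF :> (_ -> _) by apply: diff_unique.
apply: DiffDef => //.
by apply/diff_locallyP; rewrite E.
Qed.

Lemma is_diff_dotv n (F : 'rV[R]_n -> R) (x l : 'rV[R]_n) (M : R) :
  (forall u, `|u| <= 1 -> `|F (u + x) - F x - dotv l u| <= M * `|u| ^+ 2) ->
  is_diff x F (dotv l).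
Proof.
move=> FM; have lin : linear (dotv l : 'rV[R]_n -> R).
  by move=> a u v; rewrite dotvDr dotvZr.
pose dlM := GRing.isLinear.Build _ _ _ _ _ lin.
pose dL : {linear 'rV[R]_n -> R} := HB.pack (dotv l : 'rV[R]_n -> R) dlM.
have dc : continuous dL.
  suff : subexp (fun y => dotv l y) by case.
  apply: subexp_dotv => i; [exact: subexp_cst|exact: subexp_coord].
exact: (@is_diff_quadratic _ _ F dL x M dc FM).
Qed.

(** Follows from [1 + s <= expR s] at [s = t] and at [s = - t]; the latter gives
    [expR t - 1 <= t * expR t]. *)
Lemma expR_remainder (t : R) : `|expR t - 1 - t| <= t ^+ 2 * expR `|t|.
Proof.
have h1 := expR_ge1Dx t.
rewrite ger0_norm; last by rewrite -addrA -opprD subr_ge0.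
have h2 : expR t - 1 <= t * expR t.
  have := expR_ge1Dx (- t); rewrite -(ler_pM2r (expR_gt0 t)) -expRD addNr expR0.
  lra.
have [t0|t0] := leP 0 t.
  by rewrite ger0_norm//; have := expR_ge0 t; nra.
have : 1 <= expR `|t| by rewrite -expR0 ler_expR.
have := expR_ge0 t; nra.
Qed.

Lemma normr_intRd_le n (g h : 'rV[R]_n -> R) : gdominated g -> gdominated h ->
  (forall y, `|g y| <= h y) -> `|intRd g| <= intRd h.
Proof.
move=> gg hh gh; rewrite ler_norml -mulN1r -intRdZ// !le_intRd//.
- by move=> y; have := gh y; rewrite ler_norml => /andP[].
- exact: gdominatedZ.
- by move=> y; have := gh y; rewrite mulN1r ler_norml => /andP[].
Qed.

Lemma subexp_expR_dotv n (k : R) (x : 'rV[R]_n) :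
  subexp (fun y => expR (k * dotv x y)).
Proof.
apply: (@subexp_expR _ _ _ (`|k| * `|x|)); first by rewrite mulr_ge0.
  apply: subexpM; first exact: subexp_cst.
  by apply: subexp_dotv => i; [exact: subexp_cst|exact: subexp_coord].
move=> y; apply: le_trans (ler_norm _) _; rewrite normrM -mulrA ler_wpM2l//.
exact: dotv_le_norm1.
Qed.

Definition laplace n (k : R) (g : 'rV[R]_n -> R) (x : 'rV[R]_n) : R :=
  intRd (fun y => expR (k * dotv x y) * g y).

(** Differentiation under the integral: the second-order remainder of the exponential kernel is
    integrated against a Gaussian-dominated bound. *)
Lemma is_diff_laplace n (k : R) (g : 'rV[R]_n -> R) (x : 'rV[R]_n) :
  gdominated g -> (forall y, 0 <= g y) ->
  is_diff x (laplace k g) (dotv (k *: \row_i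
    intRd (fun y => y 0 i * (expR (k * dotv x y) * g y)))).
Proof.
move=> gg g0; set l := \row_i _.
pose h y := expR (k * dotv x y) * g y.
have hh : gdominated h by apply: gdominatedM => //; exact: subexp_expR_dotv.
have h0 y : 0 <= h y by rewrite mulr_ge0 ?expR_ge0.
have hi i : gdominated (fun y => y 0 i * h y).
  by apply: gdominatedM => //; exact: subexp_coord.
(* For increments [u] of norm at most 1, [expR_remainder] at [k * dotv u y] is bounded by |u|^2
   times [B y]. *)
pose B (y : 'rV[R]_n) := (k * norm1 y) ^+ 2 * expR (`|k| * norm1 y).
have BB : gdominated (fun y => B y * h y).
  apply: gdominatedM => //; apply: subexpM.
    rewrite (_ : (fun _ => _) = fun y => k * norm1 y * (k * norm1 y)); last first.
      by apply/funext => y; rewrite expr2.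
    by apply: subexpM; apply: subexpM; (exact: subexp_cst || exact: subexp_norm1).
  apply: (@subexp_expR _ _ _ `|k|) => //.
  by apply: subexpM; [exact: subexp_cst|exact: subexp_norm1].
apply: (@is_diff_dotv _ _ _ _ (intRd (fun y => B y * h y))) => u u1.
have lE : dotv (k *: l) u = intRd (fun y => (k * dotv u y) * h y).
  have -> : (fun y => k * dotv u y * h y) =
      (fun y => \sum_i (k * u 0 i) * (y 0 i * h y)).
    apply/funext => y; rewrite /dotv mulr_sumr mulr_suml.
    by apply: eq_bigr => i _; ring.
  have [_ ->] := intRd_sum (fun i => gdominatedZ (k * u 0 i) (hi i)).
  rewrite dotvZl mulr_sumr; apply: eq_bigr => i _.
  by rewrite intRdZ// mxE mulrAC mulrA.
have uh : gdominated (fun y => k * dotv u y * h y).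
  apply: gdominatedM => //; apply: subexpM; first exact: subexp_cst.
  by apply: subexp_dotv => i; [exact: subexp_cst|exact: subexp_coord].
have eh : gdominated (fun y => expR (k * dotv u y) * h y).
  by apply: gdominatedM => //; exact: subexp_expR_dotv.
rewrite lE; have -> : laplace k g (u + x) = intRd (fun y => expR (k * dotv u y) * h y).
  congr intRd; apply/funext => y.
  by rewrite /h mulrA -expRD -mulrDr -dotvDl.
rewrite -[laplace k g x]/(intRd h).
(* Differences are written with the scalar [-1], so that [intRdD] and [intRdZ] handle them. *)
have gN1 a : gdominated a -> gdominated (fun y : 'rV[R]_n => -1 * a y).
  exact: gdominatedZ.
have -> : intRd (fun y => expR (k * dotv u y) * h y) - intRd h -
    intRd (fun y => k * dotv u y * h y) =
    intRd (fun y => expR (k * dotv u y) * h y +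
      (-1 * h y + -1 * (k * dotv u y * h y))).
  rewrite intRdD ?intRdD ?intRdZ ?mulN1r ?addrA//; first exact: gN1.
    exact: gN1.
  by apply: gdominatedD; exact: gN1.
rewrite mulrC -intRdZ//; apply: normr_intRd_le.
- by apply: gdominatedD => //; apply: gdominatedD; exact: gN1.
- exact: gdominatedZ.
move=> y; set t := k * dotv u y.
have -> : expR t * h y + (-1 * h y + -1 * (t * h y)) = (expR t - 1 - t) * h y.
  by ring.
rewrite normrM (ger0_norm (h0 y)) mulrA ler_wpM2r//.
apply: le_trans (expR_remainder t) _; rewrite /B mulrA.
have tN : `|t| <= `|k| * (`|u| * norm1 y).
  by rewrite normrM ler_wpM2l// dotv_le_norm1.
apply: ler_pM; rewrite ?sqr_ge0 ?expR_ge0//.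
  rewrite -[t ^+ 2]real_normK ?num_real// -exprMn -[leRHS]real_normK ?num_real//.
  rewrite ler_sqr ?nnegrE// (le_trans tN)//.
  by rewrite !normrM normr_id (ger0_norm (norm1_ge0 y)) mulrCA.
rewrite ler_expR (le_trans tN)// ler_wpM2l// ler_piMl//; exact: norm1_ge0.
Qed.

End LaplaceTransform.

(** Serves as the first-order expansion of the dilation factor [(1 - r) ^+ d]. *)
Lemma bernoulli_inequality (R : realDomainType) n (r : R) : 0 <= r <= 1 ->
  1 - n%:R * r <= (1 - r) ^+ n.
Proof.
move=> /andP[r0 r1]; elim: n => [|n IH]; first by rewrite mul0r subr0.
rewrite exprS; have r1' : 0 <= 1 - r by rewrite subr_ge0.
apply: le_trans (ler_wpM2l r1' IH).
have -> : (1 - r) * (1 - n%:R * r) = 1 - n.+1%:R * r + n%:R * (r * r).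
  by rewrite -natr1; ring.
by rewrite lerDl !mulr_ge0.
Qed.

(** * The Gibbs density, its mean [zprox], and the gradient of the envelope *)

Section GibbsDensity.
Variables (R : realType) (d : nat) (lam del : R) (f : 'rV[R]_d -> R).
Hypotheses (lam0 : 0 < lam) (del0 : 0 < del).
Hypotheses (fconvex : convex_fun f) (fcont : continuous f).
Hypothesis fmin : argmin f !=set0.

Let sig := lam * del.

Let sig0 : 0 < sig. Proof. exact: mulr_gt0. Qed.

Definition gibbs_weight (y : 'rV[R]_d) : R :=
  expR (- f y / del) * expR (- dotv y y / (2 * sig)).

(** Up to a factor independent of [y], this is
    [exp (- f y / del - |y - x|^2 / (2 lam del))]; expanding the square makes
    the integral of [gibbs x] a Laplace transform in [x]. *)
Definition gibbs (x y : 'rV[R]_d) : R := expR (sig^-1 * dotv x y) * gibbs_weight y.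

Let partition := laplace sig^-1 gibbs_weight.

(** A minimizer [m] bounds the first factor by [expR (- f m / del)]; the second factor provides the
    decay. *)
Lemma gibbs_weight_gdominated : gdominated gibbs_weight.
Proof.
have [m fm] := fmin; exists (expR (- f m / del)), (2 * sig)^-1.
split; first by rewrite invr_gt0 mulr_gt0.
split=> [y|y].
  have cq : subexp (fun y : 'rV[R]_d => - dotv y y / (2 * sig)).
    rewrite (_ : (fun _ => _) = fun y => - (2 * sig)^-1 * dotv y y); last first.
      by apply/funext => w; rewrite mulNr mulrC mulNr.
    apply: subexpM; first exact: subexp_cst.
    by apply: subexp_dotv => i; exact: subexp_coord.
  have expc (phi : 'rV[R]_d -> R) : continuous phi -> continuous (expR \o phi).
    by move=> phic w; apply: continuous_comp; [exact: phic|exact: continuous_expR].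
  have cf : continuous (fun y : 'rV[R]_d => - f y / del).
    rewrite (_ : (fun _ => _) = fun y => - del^-1 * f y); last first.
      by apply/funext => w; rewrite mulNr mulrC mulNr.
    by move=> w; exact: cvgM (cvg_cst _) (@fcont w).
  exact: cvgM (expc _ cf y) (expc _ cq.1 y).
rewrite normrM !ger0_norm ?expR_ge0//; apply: ler_pM; rewrite ?expR_ge0//.
  by rewrite ler_expR ler_pM2r ?invr_gt0// lerN2.
by rewrite ler_expR !mulNr mulrC.
Qed.

Lemma gibbs_gdominated x : gdominated (gibbs x).
Proof.
by apply: gdominatedM; [exact: gibbs_weight_gdominated|exact: subexp_expR_dotv].
Qed.

Lemma gibbs_gt0 x y : 0 < gibbs x y.
Proof. by rewrite !mulr_gt0 ?expR_gt0. Qed.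

Let partition_gt0 x : 0 < partition x.
Proof. by apply: intRd_gt0; [exact: gibbs_gdominated|exact: gibbs_gt0]. Qed.

Let moment_gdominated x (phi : 'rV[R]_d -> R) :
  subexp phi -> gdominated (fun y => phi y * gibbs x y).
Proof. by move=> ?; apply: gdominatedM => //; exact: gibbs_gdominated. Qed.

Let gauss_cst := ((2 * pi * sig) `^ (d%:R / 2))^-1.

Let gauss_cst_gt0 : 0 < gauss_cst.
Proof. by rewrite invr_gt0 powR_gt0// !mulr_gt0// pi_gt0. Qed.

(** Expanding |y - x|^2 leaves a prefactor independent of [phi], which cancels in the quotient
    defining [zprox]. *)
Lemma gaussE_gibbs x (phi : 'rV[R]_d -> R) : subexp phi ->
  gaussE sig x (fun y => phi y * expR (- f y / del)) =
  gauss_cst * expR (- dotv x x / (2 * sig)) * intRd (fun y => phi y * gibbs x y).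
Proof.
move=> hphi; rewrite -intRdZ; last exact: moment_gdominated.
congr intRd; apply/funext => y; rewrite /gauss_dens -/gauss_cst.
have -> : - dotv (y - x) (y - x) / (2 * sig) =
   - dotv x x / (2 * sig) + (sig^-1 * dotv x y + - dotv y y / (2 * sig)).
  by rewrite !dotvE (dotvC y x); field; rewrite gt_eqF.
by rewrite !expRD /gibbs /gibbs_weight; ring.
Qed.

Lemma gaussE_partition x : gaussE sig x (fun y => expR (- f y / del)) =
  gauss_cst * expR (- dotv x x / (2 * sig)) * partition x.
Proof.
have := gaussE_gibbs x (subexp_cst d 1).
have E h : (fun y : 'rV[R]_d => 1 * h y) = h by apply/funext => y; rewrite mul1r.
by rewrite !E.
Qed.

Lemma zprox_gibbs x : zprox lam del f x =
  (intRd (gibbs x))^-1 *: \row_i intRd (fun y => y 0 i * gibbs x y).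
Proof.
rewrite /zprox gaussE_partition; apply/rowP => i; rewrite !mxE.
rewrite -/sig (gaussE_gibbs x (subexp_coord R i)).
have -> : intRd (gibbs x) = partition x by [].
have := partition_gt0 x; have := gauss_cst_gt0.
have := expR_gt0 (- dotv x x / (2 * sig)).
move: (expR _) (intRd _) (partition x) => e N Z e0 c0 Z0.
by field; rewrite !gt_eqF.
Qed.

Lemma intRd_gibbs_coord x i :
  intRd (fun y => y 0 i * gibbs x y) = intRd (gibbs x) * zprox lam del f x 0 i.
Proof.
by rewrite zprox_gibbs !mxE mulrA divff ?mul1r// gt_eqF ?partition_gt0.
Qed.

Lemma soft_moreau_partition x : soft_moreau lam del f x =
  - del * ln gauss_cst + (2 * lam)^-1 * dotv x x + - del * ln (partition x).
Proof.
rewrite /soft_moreau gaussE_partition !lnM ?posrE ?mulr_gt0 ?expR_gt0//.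
rewrite expRK /sig; field.
by rewrite !gt_eqF.
Qed.

(** The quadratic term contributes x / lam. The logarithmic gradient of [partition] is the mean
    divided by lam del, so the last term contributes - z / lam. *)
Lemma is_diff_soft_moreau (x : 'rV[R]_d) : is_diff x (soft_moreau lam del f)
  (dotv (lam^-1 *: (x - zprox lam del f x))).
Proof.
have -> : soft_moreau lam del f = cst (- del * ln gauss_cst) +
    (2 * lam)^-1 *: (fun y : 'rV[R]_d => dotv y y : R) + (- del) *: (@ln R \o partition).
  by apply/funext => y; rewrite soft_moreau_partition.
have d1 : is_diff x (fun y : 'rV[R]_d => dotv y y : R) (dotv (2 *: x)).
  (* The remainder is [dotv u u], at most [d] times the square of the maximum norm. *)
  apply: (@is_diff_dotv _ _ _ _ _ d%:R) => u _.
  have -> : dotv (u + x) (u + x) - dotv x x - dotv (2 *: x) u = dotv u u.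
    by rewrite !dotvE (dotvC u x); ring.
  rewrite ger0_norm ?dotv_ge0// /dotv.
  have -> : d%:R = \sum_(i < d) 1 :> R by rewrite sumr_const card_ord.
  rewrite mulr_suml ler_sum// => i _; rewrite mul1r.
  by rewrite -expr2 -real_normK ?num_real// ler_sqr ?nnegrE// normr_coord_le.
have d2 : is_diff x partition (dotv (sig^-1 *: \row_i
    intRd (fun y => y 0 i * gibbs x y))).
  apply: is_diff_laplace; first exact: gibbs_weight_gdominated.
  by move=> y; rewrite mulr_ge0 ?expR_ge0.
have d3 : is_diff (partition x) (@ln R) ( *:%R^~ (partition x)^-1).
  have dln := is_derive1_ln (partition_gt0 x).
  have [dl El] := dln.
  by apply: DiffDef; [exact/derivable1_diffP|rewrite deriv1E// derive1E El].
apply: is_diff_eq; apply/funext => u.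
rewrite !fctE /= zprox_gibbs -[intRd (gibbs x)]/(partition x) !dotvE.
have Z0 := partition_gt0 x.
move: (partition x) (dotv (\row_i _) u) Z0 => Z N Z0.
rewrite -[0 u]/(0 : R) /GRing.scale /= /sig; field.
by rewrite !gt_eqF.
Qed.

Lemma grad_soft_moreau x :
  grad (soft_moreau lam del f) x = lam^-1 *: (x - zprox lam del f x).
Proof.
have [dF EF] := is_diff_soft_moreau x.
apply/rowP => i; rewrite mxE deriveE// EF /dotv (bigD1 i)//= big1 ?addr0.
  by rewrite [X in _ * X = _]mxE !eqxx mulr1.
by move=> j ji; rewrite [X in _ * X]mxE (negbTE ji) andbF mulr0.
Qed.

(** The terms linear in [y - z] are gathered in one vector [b], independent of [r] and [y], so that
    they integrate to zero. *)
Lemma gibbs_contraction x y0 : exists b, forall r y, 0 <= r <= 1 ->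
  let z := zprox lam del f x in
  gibbs x y * (1 + r / del * (f z - f y0 + lam^-1 * dotv (z - x) (z - y0) +
      dotv b (y - z) - r * ((2 * lam)^-1 * dotv (y - y0) (y - y0)))) <=
  gibbs x ((1 - r) *: y + r *: y0).
Proof.
move=> /=; move: (zprox lam del f x) => z.
have [a fa] := convex_subgradient z fconvex.
(* The second summand is the gradient at y = z of <y - x, y - y0> / lam. *)
exists (a + lam^-1 *: ((z - x) + (z - y0))) => r y /andP[r0 r1] /=.
set th := r / del * _; pose ys := (1 - r) *: y + r *: y0.
suff h : th + (sig^-1 * dotv x y + (- f y / del + - dotv y y / (2 * sig))) <=
    sig^-1 * dotv x ys + (- f ys / del + - dotv ys ys / (2 * sig)).
  rewrite /gibbs /gibbs_weight -!expRD.
  apply: le_trans (ler_wpM2l (expR_ge0 _) (expR_ge1Dx th)) _.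
  by rewrite -expRD ler_expR addrC.
have fys : f ys <= (1 - r) * f y + r * f y0.
  have := @fconvex y y0 (1 - r); rewrite subKr; apply.
  by rewrite subr_ge0 r1 gerBl.
have fy := fa y.
have yz := dotv_ge0 (y - z).
have -> : - f ys / del = - (1 - r) * f y / del - r * f y0 / del +
    ((1 - r) * f y + r * f y0 - f ys) / del by field; rewrite gt_eqF.
rewrite -subr_ge0.
(* Three nonnegative gaps remain: convexity on the segment, the subgradient inequality at [z], and
   the |y - z|^2 left by expanding <y - x, y - y0> about [z]. *)
have -> : sig^-1 * dotv x ys + (- (1 - r) * f y / del - r * f y0 / del +
    ((1 - r) * f y + r * f y0 - f ys) / del + - dotv ys ys / (2 * sig)) -
    (th + (sig^-1 * dotv x y + (- f y / del + - dotv y y / (2 * sig)))) =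
    ((1 - r) * f y + r * f y0 - f ys) / del +
    r / del * (f y - (f z + dotv a (y - z))) + r / del / lam * dotv (y - z) (y - z).
  rewrite /th /ys /sig !dotvE ?(dotvC y0 y) ?(dotvC y x) ?(dotvC y0 x) ?(dotvC y z).
  rewrite ?(dotvC y0 z) ?(dotvC z x); field.
  by rewrite !gt_eqF.
apply: addr_ge0; [apply: addr_ge0|].
- by rewrite divr_ge0 ?subr_ge0// ltW.
- by rewrite mulr_ge0 ?subr_ge0// divr_ge0// ltW.
- by rewrite mulr_ge0// divr_ge0 ?(ltW lam0)// divr_ge0// ltW.
Qed.

Lemma gap_le_dim x y0 : let z := zprox lam del f x in
  f z - f y0 + lam^-1 * dotv (z - x) (z - y0) <= d%:R * del.
Proof.
set z := zprox lam del f x => /=; set w0 := _ + lam^-1 * _.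
have [b hb] := gibbs_contraction x y0.
pose Z := intRd (gibbs x); have Z0 : 0 < Z := partition_gt0 x.
pose q y := (2 * lam)^-1 * dotv (y - y0) (y - y0).
have q0 y : 0 <= q y by rewrite mulr_ge0 ?dotv_ge0// invr_ge0 mulr_ge0// ltW.
have sq : subexp q.
  apply: subexpM; first exact: subexp_cst.
  by apply: subexp_dotv => i; exact: subexp_coordD.
pose B := intRd (fun y => q y * gibbs x y).
have B0 : 0 <= B by apply: intRd_ge0 => y; rewrite mulr_ge0// ltW// gibbs_gt0.
have centered : intRd (fun y => dotv b (y - z) * gibbs x y) = 0.
  pose g i (y : 'rV[R]_d) := b 0 i * (y 0 i * gibbs x y + - z 0 i * gibbs x y).
  have gi i : gdominated (fun y => y 0 i * gibbs x y + - z 0 i * gibbs x y).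
    apply: gdominatedD; first by apply: moment_gdominated; exact: subexp_coord.
    exact/gdominatedZ/gibbs_gdominated.
  have -> : (fun y => dotv b (y - z) * gibbs x y) = (fun y => \sum_i g i y).
    apply/funext => y; rewrite /dotv mulr_suml; apply: eq_bigr => i _.
    by rewrite /g !mxE; ring.
  have [_ ->] := intRd_sum (fun i => gdominatedZ (b 0 i) (gi i)).
  apply: big1 => i _; rewrite intRdZ// intRdD; last 2 first.
  - by apply: moment_gdominated; exact: subexp_coord.
  - exact/gdominatedZ/gibbs_gdominated.
  rewrite intRdZ; last exact: gibbs_gdominated.
  by rewrite intRd_gibbs_coord; ring.
(* The dilation identity rewrites the right-hand side as [(1 - r) ^+ d] times an integral, and the
   contraction bound is integrated termwise. *)
have key r : 0 < r -> r < 1 -> (1 - r) ^+ d * (Z + r / del * (w0 * Z - r * B)) <= Z.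
  move=> r0 r1; have s0 : 0 < 1 - r by rewrite subr_gt0.
  rewrite -[leRHS](intRd_affine (r *: y0) s0 (gibbs_gdominated x)); last first.
    by move=> y; rewrite ltW// gibbs_gt0.
  rewrite ler_pM2l ?exprn_gt0//.
  have pg := gibbs_gdominated x.
  have cg : gdominated (fun y => dotv b (y - z) * gibbs x y).
    apply: moment_gdominated; apply: subexp_dotv => i; first exact: subexp_cst.
    exact: subexp_coordD.
  have qg := moment_gdominated x sq.
  have -> : Z + r / del * (w0 * Z - r * B) =
      intRd (fun y => (1 + r / del * w0) * gibbs x y +
        (r / del * (dotv b (y - z) * gibbs x y) +
         - (r / del * r) * (q y * gibbs x y))).
    rewrite intRdD ?intRdD ?intRdZ//; do ?[exact: gdominatedZ].
      by rewrite centered /Z /B; ring.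
    by apply: gdominatedD; exact: gdominatedZ.
  apply: le_intRd; last first.
  - move=> y; have r01 : 0 <= r <= 1 by rewrite !ltW.
    apply: le_trans (hb r y r01); rewrite le_eqVlt; apply/orP; left; apply/eqP.
    by rewrite -/w0 /q; ring.
  - exact: gdominated_affine.
  - apply: gdominatedD; first exact: gdominatedZ.
    by apply: gdominatedD; exact: gdominatedZ.
(* In place of a limit, one explicit small [r] contradicts [key] if [w0] exceeds [d%:R * del] by
   [e > 0]. *)
rewrite leNgt; apply/negP => w0_gt.
pose e := w0 - d%:R * del; have e0 : 0 < e by rewrite subr_gt0.
have dd0 : 0 <= d%:R * del by rewrite mulr_ge0// ltW.
have w00 : 0 < w0 by exact: le_lt_trans dd0 w0_gt.
have dwZ : 0 <= d%:R * (w0 * Z) by rewrite !mulr_ge0// ltW.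
(* The first two terms are the coefficients of the error linear in [r]; the summand [e * Z] forces
   [r <= 1 / 2]. As [r * T = e * Z / 2], the error stays below half of [e * Z]. *)
pose T := B + d%:R * (w0 * Z) + e * Z.
have eZ0 : 0 < e * Z by rewrite mulr_gt0.
have T0 : 0 < T by rewrite /T ltr_wpDl// addr_ge0.
pose r := e * Z / (2 * T).
have r0 : 0 < r by rewrite divr_gt0// mulr_gt0.
have rT : r * T = e * Z / 2 by rewrite /r; field; rewrite gt_eqF.
have r1 : r < 1.
  rewrite /r ltr_pdivrMr ?mulr_gt0// mul1r /T; lra.
have eZw : e * Z <= w0 * Z by rewrite ler_pM2r// /e gerBl.
have {}key := key r r0 r1.
have rB : r * B <= e * Z / 2.
  by rewrite -rT ler_pM2l// /T; lra.
(* Bernoulli's bound may replace the power only in front of a nonnegative factor. *)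
have G0 : 0 <= w0 * Z - r * B by lra.
have bern : 1 - d%:R * r <= (1 - r) ^+ d.
  by apply: bernoulli_inequality; rewrite !ltW.
have : (1 - d%:R * r) * (Z + r / del * (w0 * Z - r * B)) <= Z.
  apply: le_trans key; rewrite ler_wpM2r// addr_ge0 ?(ltW Z0)// mulr_ge0//.
  by rewrite divr_ge0// ltW.
rewrite -subr_le0.
have -> : (1 - d%:R * r) * (Z + r / del * (w0 * Z - r * B)) - Z = r / del *
    (e * Z - r * B - d%:R * (w0 * Z) * r + d%:R * (r * (r * B))).
  by rewrite /e; field; rewrite gt_eqF.
rewrite (pmulr_rle0 _ (divr_gt0 r0 del0)) => h.
have rrB : 0 <= d%:R * (r * (r * B)).
  exact: mulr_ge0 (ler0n _ _) (mulr_ge0 (ltW r0) (mulr_ge0 (ltW r0) B0)).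
have reZ : 0 < r * (e * Z) by rewrite mulr_gt0.
have rTE : r * T = r * B + d%:R * (w0 * Z) * r + r * (e * Z) by rewrite /T; ring.
lra.
Qed.

End GibbsDensity.

(** * The subdifferential inclusion and the gap along the iterates *)

Section Main.
Variables (R : realType) (d : nat).

(** For [g > 0], [a / g] is a lower bound of the distances, hence of their infimum; for [g = 0] any
    point of [S] gives [a <= 0]. *)
Lemma dist_set_ge (x : 'rV[R]_d) (S : set 'rV[R]_d) (a g : R) :
  S !=set0 -> 0 <= g -> (forall y, S y -> a <= g * enorm (x - y)) ->
  a <= g * dist_set x S.
Proof.
move=> [y0 Sy0]; rewrite le_eqVlt => /predU1P[<- ag|g0 ag].
  by have := ag _ Sy0; rewrite !mul0r.
rewrite mulrC -ler_pdivrMr//; apply: lb_le_inf.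
  by exists (enorm (x - y0)), y0.
by move=> _ [y Sy <-]; rewrite ler_pdivrMr// mulrC; exact: ag.
Qed.

End Main.

Unset Implicit Arguments.
Set Strict Implicit.

Theorem theorem14 (R : realType) (d : nat) (lam del : R)
  (f : 'rV[R]_d -> R) :
  (0 < d)%N -> 0 < lam -> 0 < del ->
  convex_fun f ->
  continuous f ->
  argmin f !=set0 ->
  (eintRd (fun y => (expR (- f y / del))%:E) < +oo)%E ->
  (forall x : 'rV[R]_d,
     differentiable (soft_moreau lam del f) x /\
     eps_subdiff f (d%:R * del) (zprox lam del f x)
       (grad (soft_moreau lam del f) x)) /\
  (forall xs : nat -> 'rV[R]_d, zoppa_seq lam del f xs ->
     forall k : nat, (1 <= k)%N ->
       f (xs k) - inf (range f) <=
         enorm (grad (soft_moreau lam del f) (xs k.-1)) *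
           dist_set (xs k) (argmin f) + d%:R * del).
Proof.
move=> _ lam0 del0 fconv fcont fmin _.
have sub x : eps_subdiff f (d%:R * del) (zprox lam del f x)
    (grad (soft_moreau lam del f) x).
  move=> y; have := gap_le_dim lam0 del0 fconv fcont fmin x y.
  rewrite (grad_soft_moreau lam0 del0 fcont fmin) /=.
  move: (zprox lam del f x) => z.
  have -> : dotv (lam^-1 *: (x - z)) (y - z) = lam^-1 * dotv (z - x) (z - y).
    by rewrite -(opprB z x) -(opprB z y) dotvZl dotvNl dotvNr opprK.
  lra.
split=> [x|xs xsE k k1]; first split=> //.
  exact: (is_diff_soft_moreau lam0 del0 fcont fmin x).(ex_diff).
have [m fm] := fmin.
have inf_ge : f m <= inf (range f).
  by apply: lb_le_inf; [exists (f m), m|move=> _ [y _ <-]; exact: fm].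
(* As [f m] is at most the infimum, replacing the infimum by [f m] can only enlarge the gap. *)
suff : f (xs k) - f m - d%:R * del <=
  enorm (grad (soft_moreau lam del f) (xs k.-1)) * dist_set (xs k) (argmin f).
  lra.
apply: dist_set_ge => [//||y fy]; first exact: sqrtr_ge0.
(* Since [xs k] is the [zprox] of [xs k.-1], the inclusion is tested at a minimizer [y];
   Cauchy-Schwarz then bounds the inner product. *)
set g := grad _ _; have := sub (xs k.-1) y; rewrite -xsE prednK// -/g => gy.
have := dotv_le_enorm g (xs k - y); have := fy m.
have -> : dotv g (xs k - y) = - dotv g (y - xs k) by rewrite -dotvNr opprB.
lra.
Qed.
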